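(* Let $p$ be a prime and let $m$ be an integer not divisible by $p$. Then $$\frac12\sum_{k=1}^{p-1}(-1)^k\frac{\binom{2k}{k}}{k\,m^{k-1}}\equiv\frac{m^p-V_p(m)}{p}\pmod p.$$
   Context: The polynomial sequence $\{V_n(x)\}_{n\ge 0}$ is defined by $V_0(x)=2$, $V_1(x)=x$, and $V_{n+1}(x)=x\,(V_n(x)+V_{n-1}(x))$ for all integers $n\ge1$. Congruences modulo $p$ between rational numbers are understood in the ring of rational numbers whose denominator is prime to $p$. *)

(* Defs.v *)
From mathcomp Require Import all_boot all_order all_algebra.

Set Implicit Arguments.
Unset Strict Implicit.
Unset Printing Implicit Defensive.

Import Order.TTheory GRing.Theory Num.Theory.
Local Open Scope ring_scope.

Fixpoint V (n : nat) : {poly int} :=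
  match n with
  | 0 => 2
  | n1.+1 => match n1 with
             | 0 => 'X
             | n0.+1 => 'X * (V n1 + V n0)
             end
  end.

Definition p_integral (p : nat) (a : rat) : bool := coprime `|denq a| p.

(* Congruence in the ring of p-integral rationals: both sides must lie in that
   ring, and their difference in the ideal generated by p there. *)
Definition rat_eqmod (p : nat) (a b : rat) : Prop :=
  [/\ p_integral p a, p_integral p b &
      exists2 c : rat, p_integral p c & a - b = p%:R * c].

(* Main.v *)
(** The polynomials have the closed form
    [V_p = sum_(0 <= j < p) p / (p - j) 'C(p - j, j) x^(p - j)], so the right
    hand side is [- sum_(1 <= j < p) 'C(p - j, j) / (p - j) m^(p - j)].  The
    two sums agree term by term: [j! 'C(p - j, j)] is the product of the
    [p - j - i] for [i < j], hence congruent to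
    [(-1)^j j (j + 1) ... (2 j - 1)], which gives
    ['C(p - j, j) = (-1)^j 'C(2 j, j) / 2] modulo [p], while
    [m^(p - j) = m^(1 - j)] by Fermat. *)
Require Import Defs.
From mathcomp Require Import all_boot all_order all_algebra all_field.
From mathcomp Require Import ring zify.

Set Implicit Arguments.
Unset Strict Implicit.
Unset Printing Implicit Defensive.

Import Order.TTheory GRing.Theory Num.Theory.
Local Open Scope ring_scope.

(** The fraction need not be in lowest terms: [numq q * d = a * denq q] and Gauss's lemma make the
    reduced denominator a divisor of [d]. *)
Lemma p_integral_frac p (a d : int) : prime p -> ~~ (p%:Z %| d)%Z ->
  p_integral p (a%:~R / d%:~R).
Proof.
move=> p_pr pNd; have d0 : d != 0 by apply: contraNneq pNd => ->; rewrite dvdz0.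
rewrite /p_integral; set q := _ / _.
have eq_q : numq q * d = a * denq q.
  apply/(@intr_inj rat); rewrite !rmorphM /= numqE /q.
  by field; rewrite intr_eq0.
have den_dvd : (`|denq q| %| `|d|)%N.
  rewrite -(Gauss_dvdr (n := `|numq q|%N)); last first.
    by rewrite coprime_sym coprime_num_den.
  by rewrite -abszM eq_q abszM dvdn_mull.
by apply: coprime_dvdl den_dvd _; rewrite coprime_sym prime_coprime.
Qed.

Lemma p_integral_denq p (q : rat) : prime p -> p_integral p q ->
  ~~ (p%:Z %| denq q)%Z.
Proof. by move=> p_pr; rewrite /p_integral coprime_sym prime_coprime. Qed.

Lemma Euclid_dvdzM p (a b : int) : prime p ->
  (p%:Z %| a * b)%Z = (p%:Z %| a)%Z || (p%:Z %| b)%Z.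
Proof. by move=> p_pr; rewrite !dvdzE abszM Euclid_dvdM. Qed.

Lemma p_integralD p q r : prime p ->
  p_integral p q -> p_integral p r -> p_integral p (q + r).
Proof.
move=> p_pr /(p_integral_denq p_pr) pq /(p_integral_denq p_pr) pr.
have -> : q + r = (numq q * denq r + numq r * denq q)%:~R
                  / (denq q * denq r)%:~R.
  rewrite -{1}(divq_num_den q) -{1}(divq_num_den r) rmorphD !rmorphM /=.
  by field; rewrite !intr_eq0 !denq_neq0.
by rewrite p_integral_frac // Euclid_dvdzM // negb_or pq.
Qed.

(** Cross-multiplication: if [a * d - b * c = k * p], the difference of the fractions is [p] times
    [k / (c * d)]. This turns a rational congruence into an integer divisibility, which can be
    checked in ['F_p]. *)
Lemma rat_eqmod_frac p (a b c d : int) : prime p ->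
    ~~ (p%:Z %| c)%Z -> ~~ (p%:Z %| d)%Z -> (p%:Z %| a * d - b * c)%Z ->
  rat_eqmod p (a%:~R / c%:~R) (b%:~R / d%:~R).
Proof.
move=> p_pr pNc pNd /dvdzP[k eq_k]; split; rewrite ?p_integral_frac //.
exists (k%:~R / (c * d)%:~R).
  by rewrite p_integral_frac // Euclid_dvdzM // negb_or pNc.
have c0 : c%:~R != 0 :> rat.
  by rewrite intr_eq0; apply: contraNneq pNc => ->; rewrite dvdz0.
have d0 : d%:~R != 0 :> rat.
  by rewrite intr_eq0; apply: contraNneq pNd => ->; rewrite dvdz0.
rewrite mulrA -[p%:R]/(p%:Z%:~R) -rmorphM /= [p%:Z * k]mulrC -eq_k.
by rewrite rmorphB !rmorphM /=; field; rewrite c0 d0.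
Qed.

Lemma rat_eqmod_sum p (I : Type) (s : seq I) (P : pred I) (F G : I -> rat) :
    prime p -> (forall i, P i -> rat_eqmod p (F i) (G i)) ->
  rat_eqmod p (\sum_(i <- s | P i) F i) (\sum_(i <- s | P i) G i).
Proof.
move=> p_pr FG; have int0 : p_integral p 0 by rewrite /p_integral coprime1n.
apply: (big_ind2 (rat_eqmod p)) => // [|a a' b b' [ia ia' [u iu eu]]].
  by split=> //; exists 0; rewrite ?mulr0 ?subr0.
move=> [ib ib' [v iv ev]]; split; rewrite ?p_integralD //.
by exists (u + v); rewrite ?p_integralD // mulrDr -eu -ev; ring.
Qed.

(** In standard notation this is the Lucas polynomial [U_(n+1)(P, Q)] with [P = x] and [Q = -x]; [V]
    is its companion sequence. Terms with [2 j > n] vanish. *)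
Definition lucasU (n : nat) : {poly int} :=
  \sum_(j < n.+1) 'C(n - j, j)%:R * 'X^(n - j).

Lemma lucasUS n :
  lucasU n.+1 = 'X^(n.+1) + \sum_(i < n) 'C(n - i, i.+1)%:R * 'X^(n - i).
Proof.
rewrite /lucasU big_ord_recl bin0 mul1r subn0 big_ord_recr /=.
by rewrite [in (n.+1 - _)%N]/bump add1n subSS subnn bin0n mul0r addr0.
Qed.

Lemma lucasUSS n : lucasU n.+2 = 'X * (lucasU n.+1 + lucasU n).
Proof.
(* The zero term [i = n] is kept so that the range matches [lucasU n]; Pascal's rule then applies
   term by term. *)
have -> : lucasU n.+1 =
    'X^(n.+1) + \sum_(i < n.+1) 'C(n - i, i.+1)%:R * 'X^(n - i).
  by rewrite lucasUS big_ord_recr /= subnn bin0n mul0r addr0.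
rewrite lucasUS -addrA mulrDr -exprS; congr (_ + _).
rewrite -big_split mulr_sumr; apply: eq_bigr => i _ /=.
by rewrite subSn -1?ltnS // binS natrD exprS; ring.
Qed.

Lemma V_lucasU n : V n.+2 = lucasU n.+2 + 'X * lucasU n.
Proof.
have U0 : lucasU 0 = 1 by rewrite /lucasU big_ord1 mulr1.
have U1 : lucasU 1 = 'X by rewrite lucasUS big_ord0 addr0.
(* Multiplying this by ['X] gives the claim, and it already makes sense at [n = 0]. The recurrence
   has order two, so the induction carries two consecutive instances. *)
suff: V n.+1 + V n = lucasU n.+1 + lucasU n + lucasU n.
  by rewrite lucasUSS [V n.+2]/= -/(V n.+1) => ->; ring.
suff [] : V n.+1 + V n = lucasU n.+1 + lucasU n + lucasU n /\
          V n.+2 + V n.+1 = lucasU n.+2 + lucasU n.+1 + lucasU n.+1 by [].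
have VSS k : V k.+2 = 'X * (V k.+1 + V k) by [].
elim: n => [|n [IH1 IH2]].
  rewrite !(VSS, lucasUSS) U0 U1 /=; split; ring.
by split=> //; rewrite (VSS n.+1) IH2 (VSS n) IH1 !lucasUSS; ring.
Qed.

(** The two [lucasU] sums combine into the coefficients ['C(n - j, j) + 'C(n - j - 1, j - 1)], and
    [(n - j) 'C(n - j - 1, j - 1) = j 'C(n - j, j)] turns them into [n / (n - j) 'C(n - j, j)]. *)
Lemma horner_V n (x : int) : (1 < n)%N ->
  (V n).[x]%:~R = x%:~R ^+ n + n%:R *
    \sum_(1 <= j < n) 'C(n - j, j)%:R * x%:~R ^+ (n - j) / (n - j)%:R :> rat.
Proof.
case: n => [|[|n]] // _; rewrite V_lucasU lucasUS big_add1 big_mkord /=.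
rewrite mulr_sumr /lucasU mulr_sumr -addrA -big_split /=.
rewrite !hornerE horner_sum rmorphD rmorphXn rmorph_sum /=; congr (_ + _).
apply: eq_bigr => i _; have := ltn_ord i; rewrite ltnS => le_in.
rewrite subSS !subSn //; set a := (n - i)%N.
have a0 : a.+1%:R != 0 :> rat by rewrite pnatr_eq0.
have -> : 'C(a.+1, i.+1)%:R * 'X^(a.+1) + 'X * ('C(a, i)%:R * 'X^a) =
    ('C(a.+1, i.+1) + 'C(a, i))%:R * 'X^(a.+1) :> {poly int}.
  by rewrite natrD exprS; ring.
rewrite -polyC_natr !hornerE rmorphM rmorphXn /= natz.
apply: (mulIf a0); rewrite mulfVK //.
rewrite mulrAC; congr (_ * _); rewrite -[_%:~R]/(_%:R) -!natrM; congr _%:R.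
have -> : n.+2 = (a.+1 + i.+1)%N by lia.
by rewrite mulnDl [('C(a, i) * _)%N]mulnC (mul_bin_diag a.+1 i) [RHS]mulnDl
  [X in (X + _)%N]mulnC.
Qed.

Lemma ffact_natr (R : nzRingType) (n k : nat) :
  (n ^_ k)%:R = \prod_(i < k) (n%:R - i%:R) :> R.
Proof.
elim: k => [|k IHk]; first by rewrite ffactn0 big_ord0.
rewrite ffactnSr natrM big_ord_recr -IHk /=.
have [le_kn | lt_nk] := leqP k n; first by rewrite natrB.
by rewrite ffact_small // !mul0r.
Qed.

Lemma dvdz_Fp p (x : int) : prime p -> (p%:Z %| x)%Z = (x%:~R == 0 :> 'F_p).
Proof. by move=> p_pr; rewrite (dvdz_pcharf (pchar_Fp p_pr)). Qed.

Lemma prime_dvd_fact p n : prime p -> (p %| n`!)%N = (p <= n)%N.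
Proof.
move=> p_pr; apply/idP/idP => [|le_pn]; last by rewrite dvdn_fact ?prime_gt0.
elim: n => [|n IHn]; first by rewrite fact0 Euclid_dvd1.
rewrite factS Euclid_dvdM // => /orP[/dvdn_leq -> //|/IHn le_pn].
exact: leqW.
Qed.

(** By Pascal's rule and symmetry. It absorbs the factor 1/2 over the integers, so that [p = 2] is
    covered as well. *)
Lemma bin_double k : (0 < k)%N -> 'C(2 * k, k) = (2 * 'C((2 * k).-1, k))%N.
Proof.
case: k => // k _; have -> : (2 * k.+1)%N = (k.+1 + k).+1 by lia.
by rewrite binS -[in 'C(_, k.+1)]bin_sub ?leq_addr // addKn mul2n addnn.
Qed.

Lemma bin_sub_prime p j : prime p -> (0 < j < p)%N ->
  'C(p - j, j)%:R = (-1) ^+ j * 'C((2 * j).-1, j)%:R :> 'F_p.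
Proof.
move=> p_pr /andP[j0 jp].
have f0 : j`!%:R != 0 :> 'F_p.
  have := dvdz_Fp j`! p_pr; rewrite dvdzE /= -[_%:~R]/(_%:R) => <-.
  by rewrite prime_dvd_fact // -ltnNge.
apply: (mulIf f0); rewrite -mulrA -!natrM !bin_ffact !ffact_natr.
rewrite natrB ?(ltnW jp) // pchar_Fp_0 // sub0r.
(* Reversal turns the factor [2 j - 1 - i] into [j + i]; the sign is spread as one -1 per factor, to
   match [- j - i] on the left. *)
rewrite [in RHS](reindex_inj rev_ord_inj) /= -[X in (-1) ^+ X]card_ord.
rewrite -prodr_const -big_split /=; apply: eq_bigr => i _.
rewrite natrB // -subn1 natrB ?muln_gt0 // natrM -natr1; ring.
Qed.

Theorem theorem1p2 (p : nat) (m : int) (p_prime : prime p)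
    (pNm : ~~ (p%:Z %| m)%Z) :
  rat_eqmod p
    (1 / 2 * \sum_(1 <= k < p)
       (-1) ^+ k * ('C(2 * k, k)%:R / (k%:R * m%:~R ^+ (k - 1))))
    ((m%:~R ^+ p - (V p).[m]%:~R) / p%:R).
Proof.
have p_gt1 := prime_gt1 p_prime.
have p0 : p%:R != 0 :> rat by rewrite pnatr_eq0 -lt0n ltnW.
have m0 : m%:~R != 0 :> rat.
  by rewrite intr_eq0; apply: contraNneq pNm => ->; rewrite dvdz0.
have addBM (a b : rat) : (a - (a + p%:R * b)) / p%:R = - b by field.
rewrite horner_V // addBM mulr_sumr -sumrN.
rewrite big_nat_cond [X in rat_eqmod _ _ X]big_nat_cond.
apply: rat_eqmod_sum => // k; rewrite andbT => kP; have /andP[k0 kp] := kP.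
have pNk i : (0 < i < p)%N -> ~~ (p%:Z %| i%:Z)%Z.
  by case/andP=> i0 ip; rewrite dvdzE /= gtnNdvd.
(* Both [k]-th terms are written as fractions of integers with denominators prime to [p]. *)
have -> : 1 / 2 * ((-1) ^+ k * ('C(2 * k, k)%:R / (k%:R * m%:~R ^+ (k - 1)))) =
    ((-1) ^+ k * 'C((2 * k).-1, k)%:Z)%:~R / (k%:Z * m ^+ (k - 1))%:~R :> rat.
  rewrite bin_double // natrM !rmorphM !rmorphXn rmorphN rmorph1 /=.
  by field; rewrite pnatr_eq0 -lt0n k0 expf_neq0.
have -> : - ('C(p - k, k)%:R * m%:~R ^+ (p - k) / (p - k)%:R) =
    (- ('C(p - k, k)%:Z * m ^+ (p - k)))%:~R / (p - k)%:Z%:~R :> rat.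
  by rewrite rmorphN rmorphM rmorphXn /= mulNr.
have pNmk n : ~~ (p%:Z %| m ^+ n)%Z.
  by move: pNm; rewrite !dvdz_Fp // rmorphXn /=; apply: expf_neq0.
apply: rat_eqmod_frac => //.
- by rewrite Euclid_dvdzM // negb_or pNk ?pNmk.
- by apply: pNk; lia.
have fermat : m%:~R ^+ (p - 1) = 1 :> 'F_p.
  apply: (mulIf (x := m%:~R)); first by rewrite -dvdz_Fp.
  by rewrite mul1r -exprSr subn1 prednK ?prime_gt0 //
    -[X in _ ^+ X]card_Fp // expf_card.
rewrite dvdz_Fp // rmorphB !rmorphM rmorphN !rmorphM.
rewrite !rmorphXn rmorphN rmorph1 /=.
rewrite -![_%:Z%:~R]/(_%:R) bin_sub_prime //.
rewrite natrB ?(ltnW kp) // pchar_Fp_0 // sub0r.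
(* Cross-multiplication brings these two powers together, and their exponents add up to [p - 1]. *)
have {fermat} : m%:~R ^+ (p - k) * m%:~R ^+ (k - 1) = 1 :> 'F_p.
  by rewrite -exprD addnBA // subnK // ltnW.
set x := m%:~R ^+ (p - k); set y := m%:~R ^+ _ => xy.
set c : 'F_p := _%:R.
apply/eqP; transitivity ((-1) ^+ k * c * k%:R * (x * y - 1)); first by ring.
by rewrite xy subrr mulr0.
Qed.
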